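(* Let $H$ be a separable infinite-dimensional complex Hilbert space. Positive compact operators on $H$ are commutators of compact operators (that is, of the form $CZ-ZC$ with $C,Z$ compact operators on $H$) when they have eigenvalue sequences $$\Bigl(d_1,\ \tfrac{d_2-d_1}{2},\ \tfrac{d_2-d_1}{2},\ \tfrac{d_3-d_2}{3},\ \tfrac{d_3-d_2}{3},\ \tfrac{d_3-d_2}{3},\ \dots\Bigr)$$ (the value $d_1$ listed once and, for each $n\ge 2$, the value $\frac{d_n-d_{n-1}}{n}$ listed $n$ times), where $0\le d_n\uparrow$ (i.e. $(d_n)_{n\ge1}$ is a nondecreasing sequence of nonnegative real numbers) but $\frac{d_n}{n}\to 0$ as $n\to\infty$. Constructing examples, particularly strictly positive ones, is easy: $d_n=\sqrt n$ or $d_n=\log n$. An equivalent and more direct condition is: if $d_n\ge 0$ for all $n\ge1$ and $\frac1n\sum_{j=1}^n d_j\to 0$ as $n\to\infty$, then the positive compact operators on $H$ with eigenvalue sequence $$\Bigl(d_1,\ \tfrac{d_2}{2},\ \tfrac{d_2}{2},\ \tfrac{d_3}{3},\ \tfrac{d_3}{3},\ \tfrac{d_3}{3},\ \dots\Bigr)$$ (for each $n\ge 1$, the value $\frac{d_n}{n}$ listed $n$ times) are single commutators $CZ-ZC$ of compact operators $C,Z$ on $H$.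
   Context: Saying that a positive compact operator $T$ on $H$ has eigenvalue sequence $(\mu_k)_{k\ge1}$ means that there is an orthonormal basis $(e_k)_{k\ge 1}$ of $H$ with $Te_k=\mu_k e_k$ for all $k$ (so eigenvalues are listed according to multiplicity, and the sequence need not be monotone). A positive operator is strictly positive if it has trivial kernel.
   Formalization: For d_n = log n, log 1 = 0 makes the first eigenvalue 0, so the operator is not strictly positive; the formal theorem claims strict positivity only for d_n = √n, and for log n states a positive operator whose eigenvalues after the first are all positive. *)

(* Defs.v *)
From HB Require Import structures.
From mathcomp Require Import all_boot all_order all_algebra.
From mathcomp Require Import sesquilinear complex.
From mathcomp Require Import all_classical all_reals all_analysis.

Set Implicit Arguments.
Unset Strict Implicit.
Unset Printing Implicit Defensive.

Import Order.TTheory GRing.Theory Num.Def Num.Theory.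
Import numFieldNormedType.Exports.

Local Open Scope classical_set_scope.
Local Open Scope complex_scope.
Local Open Scope ring_scope.

Definition separable (X : topologicalType) : Prop :=
  exists D : set X, countable D /\ dense D.

Definition infinite_dimensional (K : nzRingType) (V : lmodType K) : Prop :=
  ~ exists (n : nat) (v : 'I_n -> V),
      forall x : V, exists a : 'I_n -> K, x = \sum_(i < n) a i *: v i.

(* A Hilbert space is a complete normed space H together with an inner product
   [ip : {dot H for conjC}] inducing its norm. [ip] is linear in its first
   argument and conjugate-linear in its second one. *)
Definition induces_norm (R : realType) (H : normedModType R[i])
    (ip : {dot H for conjC}) : Prop :=
  forall x : H, `|x| ^+ 2 = ip x x.

Definition orthonormal_basis (R : realType) (H : normedModType R[i])
    (ip : {dot H for conjC}) (e : nat -> H) : Prop :=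
  (forall j k : nat, ip (e j) (e k) = (j == k)%:R) /\
  (forall x : H,
     (\sum_(0 <= k < n) ip x (e k) *: e k) @[n --> \oo] --> x).

Definition compact_operator (R : realType) (H : normedModType R[i])
    (T : {linear H -> H}) : Prop :=
  precompact (T @` [set x : H | `|x| <= 1]).

(* The order of [R[i]] is partial: [0 <= z] says that z is real and
   nonnegative. *)
Definition positive_operator (R : realType) (H : normedModType R[i])
    (ip : {dot H for conjC}) (T : {linear H -> H}) : Prop :=
  forall x : H, 0 <= ip (T x) x.

Definition strictly_positive_operator (R : realType) (H : normedModType R[i])
    (ip : {dot H for conjC}) (T : {linear H -> H}) : Prop :=
  positive_operator ip T /\ forall x : H, T x = 0 -> x = 0.

(* Eigenvalue sequences are indexed from 0. *)
Definition has_eigenvalue_sequence (R : realType) (H : normedModType R[i])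
    (ip : {dot H for conjC}) (T : {linear H -> H}) (mu : nat -> R) : Prop :=
  exists2 e : nat -> H,
    orthonormal_basis ip e & forall k : nat, T (e k) = (mu k)%:C *: e k.

Definition commutator_of_compacts (R : realType) (H : normedModType R[i])
    (T : {linear H -> H}) : Prop :=
  exists C Z : {linear H -> H},
    [/\ compact_operator C, compact_operator Z
      & forall x : H, T x = C (Z x) - Z (C x)].

(* The sequence a 1, a 2, a 2, a 3, a 3, a 3, ..., each [a n] with n >= 1 being
   listed n times. The blocks 1, ..., k.+1 have total length at least k.+1, so
   the entry of index k always lies within them. *)
Definition block_sequence (R : realType) (a : nat -> R) (k : nat) : R :=
  nth 0 (flatten [seq nseq n (a n) | n <- iota 1 k.+1]) k.

(* The value [d 0] is never used: the sequences d below are indexed from 1. *)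
Definition difference_sequence (R : realType) (d : nat -> R) : nat -> R :=
  block_sequence
    (fun n => if n == 1%N then d 1%N else (d n - d n.-1) / n%:R).

Definition quotient_sequence (R : realType) (d : nat -> R) : nat -> R :=
  block_sequence (fun n => d n / n%:R).

Definition difference_condition (R : realType) (d : nat -> R) : Prop :=
  [/\ forall n : nat, (1 <= n)%N -> 0 <= d n,
      forall m n : nat, (1 <= m)%N -> (m <= n)%N -> d m <= d n
    & (d n / n%:R) @[n --> \oo] --> (0 : R)].

Definition average_condition (R : realType) (d : nat -> R) : Prop :=
  (forall n : nat, (1 <= n)%N -> 0 <= d n) /\
  (n%:R^-1 * \sum_(1 <= j < n.+1) d j) @[n --> \oo] --> (0 : R).

(* Main.v *)
Require Import Defs.
From HB Require Import structures.
From mathcomp Require Import all_boot all_order all_algebra.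
From mathcomp Require Import sesquilinear complex.
From mathcomp Require Import all_classical all_reals all_analysis.
From mathcomp Require Import ring lra.

Set Implicit Arguments.
Unset Strict Implicit.
Unset Printing Implicit Defensive.

Import Order.TTheory GRing.Theory Num.Def Num.Theory.
Import numFieldNormedType.Exports.

Local Open Scope classical_set_scope.
Local Open Scope complex_scope.
Local Open Scope ring_scope.

(* Write the operator in an orthonormal basis [E n i], i <= n, whose n-th block
   (counted from 0) has n + 1 vectors, and regard [E n i] as the monomial
   z1^i z2^(n - i). Let B1, B2 multiply by z1, z2 with weight u_n on degree n,
   and let A1, A2 be the correspondingly weighted derivatives, scaled so that
   A1 E(n+1,i+1) = (i+1)/(n+1) u_n E(n,i), and similarly for A2. The B's
   commute, and so do the A's, hence C = A1 + B2 and Z = B1 - A2 satisfy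
   CZ - ZC = [A1, B1] + [A2, B2], which is the scalar
   u_n^2 (n+2)/(n+1) - u_(n-1)^2 on degree n. With u_n^2 = d_(n+1)/(n+2) this is
   (d_(n+1) - d_n)/(n+1), and d_n/n -> 0 makes u_n -> 0, so that C and Z are
   compact, as limits of finite rank operators. *)

(** * Orthonormal families *)

Definition orthonormal_family (R : realType) (H : normedModType R[i])
    (ip : {dot H for conjC}) (f : nat -> H) : Prop :=
  forall j k : nat, ip (f j) (f k) = (j == k)%:R.

Lemma ip_conj (R : realType) (H : normedModType R[i])
    (ip : {dot H for conjC}) (x y : H) : ip x y = conjC (ip y x).
Proof. by rewrite hermC expr0 mul1r. Qed.

Lemma norm_le_sqr (R : realType) (H : normedModType R[i]) (x : H) (M : R[i]) :
  0 <= M -> `|x| ^+ 2 <= M ^+ 2 -> `|x| <= M.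
Proof. by move=> M0; rewrite ler_sqr ?nnegrE. Qed.

(** Orthonormality is asked only against [f k] and over the range of summation: the Gram-Schmidt
    induction has no more than that at hand. *)
Lemma ip_delta_suml (R : realType) (H : normedModType R[i])
    (ip : {dot H for conjC}) (f : nat -> H) (c : nat -> R[i]) (m n k : nat) :
  (forall j, (m <= j < n)%N -> ip (f j) (f k) = (j == k)%:R) ->
  ip (\sum_(m <= j < n) c j *: f j) (f k) = if (m <= k < n)%N then c k else 0.
Proof.
move=> fk; rewrite linear_sumlz big_nat /=.
under eq_bigr => j jmn do rewrite linearZl_LR /= fk//.
rewrite -big_nat; case: ifPn => mkn.
  rewrite (bigD1_seq k) ?mem_index_iota ?iota_uniq //= eqxx mulr1 big1 ?addr0//.
  by move=> j jk; rewrite (negbTE jk) mulr0.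
rewrite big_nat big1// => j jmn; case: eqP => [jk|_]; last by rewrite mulr0.
by rewrite -jk jmn in mkn.
Qed.

Lemma ip_orthonormal_suml (R : realType) (H : normedModType R[i])
    (ip : {dot H for conjC}) (f : nat -> H) (c : nat -> R[i]) (m n k : nat) :
  orthonormal_family ip f ->
  ip (\sum_(m <= j < n) c j *: f j) (f k) = if (m <= k < n)%N then c k else 0.
Proof. by move=> of_; apply: ip_delta_suml => j _; exact: of_. Qed.

Lemma sqr_norm_orthonormal_sum (R : realType) (H : normedModType R[i])
    (ip : {dot H for conjC}) (f : nat -> H) (c : nat -> R[i]) (m n : nat) :
  induces_norm ip -> orthonormal_family ip f ->
  `|\sum_(m <= k < n) c k *: f k| ^+ 2 = \sum_(m <= k < n) `|c k| ^+ 2.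
Proof.
move=> ip_norm of_; rewrite ip_norm linear_sumr big_nat [RHS]big_nat.
apply: eq_bigr => k mkn; rewrite linearZr_LR /= ip_orthonormal_suml// mkn.
by rewrite mulrC normCK.
Qed.

(** Pythagoras: the residual is orthogonal to the projection [p]. *)
Lemma sqr_norm_residual (R : realType) (H : normedModType R[i])
    (ip : {dot H for conjC}) (f : nat -> H) (x : H) (m n : nat) :
  induces_norm ip -> orthonormal_family ip f ->
  `|x - \sum_(m <= k < n) ip x (f k) *: f k| ^+ 2 =
  `|x| ^+ 2 - \sum_(m <= k < n) `|ip x (f k)| ^+ 2.
Proof.
move=> ip_norm of_; set p := \sum_(m <= k < n) ip x (f k) *: f k.
have px : ip (x - p) p = 0.
  rewrite /p linear_sumr big_nat big1// => k mkn.
  by rewrite linearZr_LR /= linearBl /= ip_orthonormal_suml// mkn subrr mulr0.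
rewrite -(sqr_norm_orthonormal_sum _ m n ip_norm of_) -/p !ip_norm.
by have := hnormDd px; rewrite subrK => ->; rewrite addrK.
Qed.

Lemma bessel (R : realType) (H : normedModType R[i])
    (ip : {dot H for conjC}) (f : nat -> H) (x : H) (m n : nat) :
  induces_norm ip -> orthonormal_family ip f ->
  \sum_(m <= k < n) `|ip x (f k)| ^+ 2 <= `|x| ^+ 2.
Proof.
move=> ip_norm of_.
by rewrite -subr_ge0 -sqr_norm_residual// exprn_ge0.
Qed.

Lemma cauchy_schwarz (R : realType) (H : normedModType R[i])
    (ip : {dot H for conjC}) (x y : H) :
  induces_norm ip -> `|ip x y| <= `|x| * `|y|.
Proof.
move=> ip_norm; have [->|y0] := eqVneq y 0.
  by rewrite linear0r !normr0 mulr0.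
have ny0 : `|y| ^+ 2 != 0 by rewrite expf_neq0 ?normr_eq0.
(* [a *: y] is the orthogonal projection of [x] on the line of [y], hence no longer than [x]. *)
pose a := ip x y / `|y| ^+ 2.
have a_orth : ip (x - a *: y) (a *: y) = 0.
  rewrite linearZr_LR /= linearBl /= linearZl_LR /=.
  rewrite -[X in a * X]ip_norm.
  by rewrite /a mulfVK// subrr mulr0.
have : 0 <= `|x - a *: y| ^+ 2 by rewrite exprn_ge0.
have := hnormDd a_orth; rewrite subrK => xE.
have -> : `|x - a *: y| ^+ 2 = `|x| ^+ 2 - `|a *: y| ^+ 2.
  by rewrite !ip_norm xE addrK.
rewrite subr_ge0 normrZ ler_sqr ?nnegrE ?mulr_ge0//.
rewrite /a normrM normfV (ger0_norm (_ : 0 <= `|y| ^+ 2)) ?exprn_ge0//.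
by rewrite expr2 invfM mulrA mulfVK ?normr_eq0// ler_pdivrMr ?normr_gt0.
Qed.

(** Orthonormality of [g] turns the norm into a sum of squares, which Bessel's inequality for [f]
    bounds. The bound is uniform in [n], so it controls whole tails and serves both convergence and
    compactness. *)
Lemma weighted_partial_sum_bound (R : realType) (H : normedModType R[i])
    (ip : {dot H for conjC}) (f g : nat -> H) (w : nat -> R) (x : H) (eps : R)
    (m n : nat) :
  induces_norm ip -> orthonormal_family ip f -> orthonormal_family ip g ->
  (forall k, (m <= k)%N -> `|w k| <= eps) ->
  `|\sum_(m <= k < n) ((w k)%:C * ip x (f k)) *: g k| <= eps%:C * `|x|.
Proof.
move=> ip_norm of_ og w_eps.
have eps0 : 0 <= eps by apply: le_trans (w_eps m (leqnn m)).
have eps0C : 0 <= eps%:C :> R[i] by rewrite ler0c.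
apply: norm_le_sqr; first by rewrite mulr_ge0.
rewrite (sqr_norm_orthonormal_sum _ _ _ ip_norm og) exprMn.
apply: (@le_trans _ _ (eps%:C ^+ 2 * \sum_(m <= k < n) `|ip x (f k)| ^+ 2)).
  rewrite mulr_sumr big_nat [leRHS]big_nat; apply: ler_sum => k /andP[mk _].
  rewrite normrM exprMn ler_wpM2r ?exprn_ge0//.
  rewrite ler_sqr ?nnegrE// normc_def /= expr0n addr0 sqrtr_sqr lecR.
  exact: w_eps.
by rewrite ler_wpM2l ?exprn_ge0// bessel.
Qed.

Lemma exists_linear (R : realType) (H : normedModType R[i]) (W : H -> H) :
  linear W -> exists W' : {linear H -> H}, W' =1 W.
Proof.
move=> linW.
pose W' : {linear H -> H} := HB.pack W (GRing.isLinear.Build R[i] H H _ W linW).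
by exists W'.
Qed.

(** * Totally bounded sets and compact operators *)

(** The centres of the net may lie outside [A], so that the property passes to subsets with the same
    net. *)
Definition totally_bounded (R : realType) (H : normedModType R[i])
    (A : set H) : Prop :=
  forall eps : R, 0 < eps -> exists s : seq H,
    forall x, A x -> exists2 y, y \in s & `|x - y| <= eps%:C.

Lemma gt0_real_complex (R : realType) (z : R[i]) :
  0 < z -> exists2 r : R, 0 < r & z = r%:C.
Proof.
move=> z0; have /complex_realP[r zE] : z \is Num.real by rewrite gtr0_real.
by exists r => //; move: z0; rewrite zE ltcR.
Qed.

Lemma ge0_real_complex (R : realType) (z : R[i]) :
  0 <= z -> exists2 r : R, 0 <= r & z = r%:C.
Proof.
move=> z0; have /complex_realP[r zE] : z \is Num.real by rewrite ger0_real.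
by exists r => //; move: z0; rewrite zE lecR.
Qed.

Lemma norm_real_complex (R : realType) (r : R) : `|r%:C| = `|r|%:C :> R[i].
Proof. by rewrite normc_def /= expr0n addr0 sqrtr_sqr. Qed.

Lemma interval_net (R : realType) (M eps : R) : 0 < eps ->
  exists s : seq R, forall a, `|a| <= M -> exists2 b, b \in s & `|a - b| <= eps.
Proof.
move=> eps0.
(* A grid of step [eps] starting at [- M]; truncation picks the last grid point not beyond [a]. *)
exists [seq k%:R * eps - M | k <- iota 0 (Num.truncn ((M + M) / eps)).+1] => a.
rewrite ler_norml => /andP[Ma aM].
have aM0 : 0 <= (a + M) / eps by rewrite divr_ge0 ?(ltW eps0)//; lra.
exists ((Num.truncn ((a + M) / eps))%:R * eps - M).
  apply/mapP; exists (Num.truncn ((a + M) / eps)) => //.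
  rewrite mem_iota add0n /= ltnS; apply: le_truncn.
  by rewrite ler_pM2r ?invr_gt0//; lra.
have /andP[] := truncn_itv aM0; move: (Num.truncn _) => k.
rewrite ler_pdivlMr// ltr_pdivrMr// -natr1 mulrDl mul1r => h1 h2.
by rewrite ler_norml; apply/andP; split; lra.
Qed.

Lemma normc_le_ReIm (R : realType) (z : R[i]) :
  `|z| <= (`|complex.Re z| + `|complex.Im z|)%:C.
Proof.
have i1 : `|'i%C : R[i]| = 1 by rewrite normc_def /= expr0n expr1n add0r sqrtr1.
rewrite {1}(complexE z) (le_trans (ler_normD _ _))//.
by rewrite normrM i1 mul1r !norm_real_complex -rmorphD.
Qed.

Lemma totally_bounded_line (R : realType) (H : normedModType R[i]) (v : H)
    (M : R) :
  totally_bounded [set c *: v | c in [set c : R[i] | `|c| <= M%:C]].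
Proof.
move=> eps eps0.
have [r r0 vE] : exists2 r : R, 0 <= r & `|v| = r%:C by exact: ge0_real_complex.
(* The 2 accounts for the real and imaginary parts; [r + 1] instead of [r] allows [v = 0]. *)
have d0 : 0 < eps / (2 * (r + 1)) by rewrite divr_gt0 ?mulr_gt0// ltr_wpDl.
have [s sP] := @interval_net R M _ d0.
exists [seq (a +i* b)%C *: v | a <- s, b <- s] => _ [c /= cM <-].
have Re_le : `|complex.Re c| <= M.
  by rewrite -lecR (le_trans _ cM)// normc_ge_Re.
have Im_le : `|complex.Im c| <= M.
  rewrite -lecR (le_trans _ cM)// normc_def lecR -[leLHS]sqrtr_sqr.
  by rewrite ler_sqrt ?lerDr ?addr_ge0// sqr_ge0.
have [a a_s ca] := sP _ Re_le; have [b b_s cb] := sP _ Im_le.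
exists ((a +i* b)%C *: v); first by apply/allpairsP; exists (a, b).
rewrite -scalerBl normrZ vE.
have -> : c - (a +i* b)%C = ((complex.Re c - a) +i* (complex.Im c - b))%C.
  by case: (c).
apply: (@le_trans _ _ ((eps / (2 * (r + 1)) * 2)%:C * (r + 1)%:C)).
  apply: ler_pM; [exact: normr_ge0|by rewrite ler0c| |by rewrite lecR lerDl].
  by apply: (le_trans (normc_le_ReIm _)); rewrite lecR /=; lra.
rewrite -rmorphM /= lecR.
  suff -> : eps / (2 * (r + 1)) * 2 * (r + 1) = eps by [].
by field; rewrite gt_eqF// ltr_wpDl.
Qed.

Lemma totally_bounded_sum (R : realType) (H : normedModType R[i])
    (A B : set H) :
  totally_bounded A -> totally_bounded B ->
  totally_bounded [set x + y | x in A & y in B].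
Proof.
move=> tbA tbB eps eps0.
have [|s sP] := tbA (eps / 2); first by rewrite divr_gt0.
have [|t tP] := tbB (eps / 2); first by rewrite divr_gt0.
exists [seq x + y | x <- s, y <- t] => _ [x Ax [y By <-]].
have [x' x's xx'] := sP _ Ax; have [y' y't yy'] := tP _ By.
exists (x' + y'); first by apply/allpairsP; exists (x', y').
rewrite opprD addrACA (le_trans (ler_normD _ _))// (splitr eps) rmorphD.
exact: lerD.
Qed.

Lemma totally_bounded_subset (R : realType) (H : normedModType R[i])
    (A B : set H) :
  A `<=` B -> totally_bounded B -> totally_bounded A.
Proof.
move=> AB tbB eps /tbB[s sP]; exists s => x /AB; exact: sP.
Qed.

(** Applied to images of the unit ball, this makes norm limits of finite rank operators compact. *)
Lemma totally_bounded_approx (R : realType) (H : normedModType R[i])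
    (A : set H) :
  (forall eps : R, 0 < eps -> exists2 B, totally_bounded B &
     forall x, A x -> exists2 y, B y & `|x - y| <= eps%:C) ->
  totally_bounded A.
Proof.
move=> tbA eps eps0.
have [|B tbB AB] := tbA (eps / 2); first by rewrite divr_gt0.
have [|s sP] := tbB (eps / 2); first by rewrite divr_gt0.
exists s => x /AB[y /sP[z zs yz] xy]; exists z => //.
rewrite -(subrKA y) (le_trans (ler_normD _ _))// (splitr eps) rmorphD.
exact: lerD.
Qed.

(** By induction on the list of pieces: an ultrafilter contains either the first piece or its
    complement. *)
Lemma ultra_has (T : Type) (I : eqType) (F : set_system T) (s : seq I)
    (P : I -> set T) :
  UltraFilter F -> F [set x | exists2 i, i \in s & P i x] ->
  exists i, F (P i).
Proof.
move=> UF; elim: s => [|i s IHs] Fs.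
  by have /filter_ex[x [j]] := Fs; rewrite in_nil.
have [Fi|FCi] := in_ultra_setVsetC (P i) UF; first by exists i.
apply: IHs; apply: filterS (filterI Fs FCi) => x [[j]].
by rewrite inE => /predU1P[->//|js] Pj _; exists j.
Qed.

(** Finite nets put a ball of every radius into each ultrafilter on the closure, so the ultrafilter
    is Cauchy and completeness provides its limit. Half of [e] pays for moving from the closure into
    [A], half for the net. *)
Lemma totally_bounded_precompact (R : realType)
    (H : completeNormedModType R[i]) (A : set H) :
  totally_bounded A -> precompact A.
Proof.
move=> tbA; rewrite precompactE compact_ultra => F UF FA.
have cauchyF : cauchy F.
  apply/cauchy_exP => _ /gt0_real_complex[e e0 ->].
  have [|s sP] := tbA (e / 2); first by rewrite divr_gt0.
  apply: (@ultra_has _ _ F s (fun y => ball y e%:C)) => //.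
  apply: filterS FA => x clAx.
  have [|a [Aa xa]] := clAx (ball x (e / 2)%:C).
    by apply: nbhsx_ballx; rewrite ltcR divr_gt0.
  have [y ys ay] := sP _ Aa; exists y => //.
  move: xa; rewrite -!ball_normE /= => xa.
  rewrite distrC -(subrKA a) (le_lt_trans (ler_normD _ _))// (splitr e) rmorphD.
  exact: ltr_leD.
have [p Fp] : exists p : H, F --> p by exists (lim F); exact: cauchy_cvg.
exists p; split => //; apply: (@closed_cvg _ _ F _ id (closure A)) => //.
exact: closed_closure.
Qed.

(** The open balls of integer radius around 0 cover the closure; a finite subcover has a largest
    radius. *)
Lemma precompact_bounded (R : realType) (H : normedModType R[i]) (A : set H) :
  precompact A -> exists M : R[i], forall x, A x -> `|x| <= M.
Proof.
rewrite precompactE compact_cover => cptA.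
have [|x _|D _ AD] := cptA nat setT (fun n => [set x : H | `|x| < n%:R]).
- move=> n _; rewrite openE => p; rewrite /= -subr_gt0 => pn.
  apply/nbhs_ballP; exists (n%:R - `|p|) => // q.
  rewrite -ball_normE /= ltrBrDr distrC; apply: le_lt_trans.
  by rewrite -{1}(subrK p q) ler_normD.
- exists (Num.truncn (complex.Re `|x|)).+1 => //=.
  have [r r0 ->] : exists2 r : R, 0 <= r & `|x| = r%:C.
    exact: ge0_real_complex.
  by rewrite -(rmorph_nat (real_complex R)) ltcR /= truncnS_gt.
exists (\max_(n <- finmap.enum_fset D) n)%N%:R => x.
move=> /subset_closure /AD[n /= nD /ltW xn].
rewrite (le_trans xn)// ler_nat.
exact: (@leq_bigmax_seq _ (finmap.enum_fset D) xpredT id).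
Qed.

(** Needed to extend the commutator identity from the basis to all of [H]. *)
Lemma compact_operator_continuous (R : realType) (H : normedModType R[i])
    (T : {linear H -> H}) : compact_operator T -> continuous T.
Proof.
move=> /precompact_bounded[M TM]; apply/linear_bounded_continuous.
apply/ex_bound; exists M; apply/nbhs_ballP; exists 1 => //= x.
rewrite -ball_normE /= sub0r normrN => /ltW x1.
by apply: TM; exists x.
Qed.

(** * Weighted sums of rank one operators *)

Lemma cvg0_le (R : realType) (w : nat -> R) (eps : R) :
  w k @[k --> \oo] --> (0 : R) -> 0 < eps ->
  exists m, forall k, (m <= k)%N -> `|w k| <= eps.
Proof.
move=> /cvgrPdist_le /(_ eps) w0 /w0[m _ wm]; exists m => k mk.
by have := wm k mk; rewrite /= sub0r normrN.
Qed.

Lemma near_ip (R : realType) (H : normedModType R[i]) (ip : {dot H for conjC})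
    (u : nat -> H) (l y : H) :
  induces_norm ip -> u n @[n --> \oo] --> l ->
  forall e : R[i], 0 < e -> \forall n \near \oo, `|ip l y - ip (u n) y| <= e.
Proof.
move=> ip_norm ul e e0.
(* The bound comes from Cauchy-Schwarz; adding 1 keeps the divisor positive when [y = 0]. *)
have e'0 : 0 < e / (`|y| + 1) by rewrite divr_gt0// ltr_wpDl.
move/cvgrPdist_le : ul => /(_ _ e'0); apply: filterS => n un.
rewrite -linearBl (le_trans (cauchy_schwarz _ _ ip_norm))//.
rewrite (@le_trans _ _ (e / (`|y| + 1) * (`|y| + 1)))//; last first.
  by rewrite divfK// gt_eqF// ltr_wpDl.
by rewrite ler_pM// lerDl.
Qed.

Lemma cvg_near_eq (R : realType) (H : normedModType R[i]) (u : nat -> H)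
    (l y : H) (N : nat) :
  (forall n, (N <= n)%N -> u n = y) -> u n @[n --> \oo] --> l -> l = y.
Proof.
move=> uy ul; apply: (cvg_unique (@norm_hausdorff _ _) ul).
apply/cvgrPdist_le => e e0; exists N => // n /= Nn.
by rewrite uy// subrr normr0 ltW.
Qed.

Lemma sum_nat_tail (V : zmodType) (F : nat -> V) (m n : nat) : (m <= n)%N ->
  \sum_(0 <= k < n) F k - \sum_(0 <= k < m) F k = \sum_(m <= k < n) F k.
Proof. by move=> mn; rewrite (@big_cat_nat _ _ _ m)//= addrAC subrr add0r. Qed.

Lemma norm_orthonormal (R : realType) (H : normedModType R[i])
    (ip : {dot H for conjC}) (f : nat -> H) (k : nat) :
  induces_norm ip -> orthonormal_family ip f -> `|f k| = 1.
Proof.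
move=> ip_norm of_; apply/eqP.
by rewrite -(@eqrXn2 _ 2)// expr1n ip_norm of_ eqxx.
Qed.

(** Each new term contributes multiples of [g m] with coefficients bounded by [|w m|], and totally
    bounded sets are stable under sums. *)
Lemma totally_bounded_partial_sum (R : realType) (H : normedModType R[i])
    (ip : {dot H for conjC}) (f g : nat -> H) (w : nat -> R) (m : nat) :
  induces_norm ip -> orthonormal_family ip f ->
  totally_bounded [set \sum_(0 <= k < m) ((w k)%:C * ip x (f k)) *: g k
                  | x in [set x : H | `|x| <= 1]].
Proof.
move=> ip_norm of_; elim: m => [|m IHm].
  move=> eps eps0; exists [:: 0] => _ [x _ <-]; exists 0; first by rewrite inE.
  by rewrite big_nil subrr normr0 ler0c ltW.
apply: totally_bounded_subset
  (totally_bounded_sum IHm (@totally_bounded_line _ _ (g m) `|w m|)).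
move=> _ [x x1 <-]; rewrite /= big_nat_recr//=.
exists (\sum_(0 <= k < m) ((w k)%:C * ip x (f k)) *: g k); first by exists x.
exists (((w m)%:C * ip x (f m)) *: g m) => //.
exists ((w m)%:C * ip x (f m)) => //=.
rewrite normrM norm_real_complex ler_piMr ?ler0c//.
rewrite (le_trans (cauchy_schwarz _ _ ip_norm))//.
by rewrite (norm_orthonormal _ ip_norm of_) mulr1.
Qed.

Lemma weighted_partial_sum_cvg (R : realType) (H : completeNormedModType R[i])
    (ip : {dot H for conjC}) (f g : nat -> H) (w : nat -> R) (x : H) :
  induces_norm ip -> orthonormal_family ip f -> orthonormal_family ip g ->
  w k @[k --> \oo] --> (0 : R) ->
  cvgn (fun n => \sum_(0 <= k < n) ((w k)%:C * ip x (f k)) *: g k).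
Proof.
move=> ip_norm of_ og w0; apply: cauchy_cvg; apply/cauchy_exP.
move=> _ /gt0_real_complex[e e0 ->].
have [r r0 xr] : exists2 r : R, 0 <= r & `|x| = r%:C by exact: ge0_real_complex.
have r1 : 0 < r + 1 by rewrite ltr_wpDl.
(* With this [m] every tail has norm at most [e * r / (r + 1)], which is strictly below [e]. *)
have [|m wm] := cvg0_le w0 (_ : 0 < e / (r + 1)); first by rewrite divr_gt0.
exists (\sum_(0 <= k < m) ((w k)%:C * ip x (f k)) *: g k).
exists m => // n /= mn.
rewrite -ball_normE /= distrC sum_nat_tail//.
have := weighted_partial_sum_bound x n ip_norm of_ og wm.
move=> /le_lt_trans; apply; rewrite xr -rmorphM ltcR.
by rewrite mulrAC ltr_pdivrMr// ltr_pM2l// ltrDl.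
Qed.

(** [W] is the strong limit of sums of rank one operators: it sends [f k] to [w k] times [g k] and
    kills the orthogonal complement of the [f k]. Diagonal operators and weighted shifts are both of
    this kind. *)
Definition weighted_sum_limit (R : realType) (H : normedModType R[i])
    (ip : {dot H for conjC}) (f g : nat -> H) (w : nat -> R) (W : H -> H) :=
  forall x, \sum_(0 <= k < n) ((w k)%:C * ip x (f k)) *: g k @[n --> \oo]
            --> W x.

Lemma weighted_sum_operator (R : realType) (H : completeNormedModType R[i])
    (ip : {dot H for conjC}) (f g : nat -> H) (w : nat -> R) :
  induces_norm ip -> orthonormal_family ip f -> orthonormal_family ip g ->
  w k @[k --> \oo] --> (0 : R) ->
  exists W : {linear H -> H},
    totally_bounded (W @` [set x : H | `|x| <= 1]) /\
    weighted_sum_limit ip f g w W.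
Proof.
move=> ip_norm of_ og w0.
pose S x n := \sum_(0 <= k < n) ((w k)%:C * ip x (f k)) *: g k.
have Scvg x : S x n @[n --> \oo] --> lim (S x n @[n --> \oo]).
  exact: weighted_partial_sum_cvg ip_norm of_ og w0.
have [W WE] : exists W : {linear H -> H},
    W =1 fun x => lim (S x n @[n --> \oo]).
  apply: exists_linear => a x y; apply: cvg_lim; first exact: norm_hausdorff.
  have -> : S (a *: x + y) = (fun n => a *: S x n + S y n).
    apply/funext => n; rewrite /S scaler_sumr -big_split; apply: eq_bigr => k _.
    by rewrite linearPl /= mulrDr scalerDl scalerA mulrCA.
  by apply: cvgD => //; exact: cvgZl_tmp.
exists W; split=> [|x]; last by rewrite WE; exact: Scvg.
(* The truncation at [m] approximates [W] within [eps] on the whole unit ball. *)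
apply: totally_bounded_approx => eps eps0.
have [m wm] := cvg0_le w0 eps0.
exists [set S x m | x in [set x : H | `|x| <= 1]].
  exact: totally_bounded_partial_sum.
move=> _ [x x1 <-]; exists (S x m); first by exists x.
(* The slack [e] absorbs the distance from [W x] to a far partial sum; what remains is a slice
   starting at [m]. *)
rewrite WE; apply/ler_addgt0Pl => e e0.
have /cvgrPdist_le/(_ _ e0)[N _ SN] := Scvg x.
have {}SN := SN _ (leq_maxr m N).
rewrite -(subrKA (S x (maxn m N))) (le_trans (ler_normD _ _))// lerD//.
rewrite sum_nat_tail ?leq_maxl//.
rewrite (le_trans (weighted_partial_sum_bound _ _ ip_norm of_ og wm))//.
by rewrite ler_piMr// ler0c ltW.
Qed.

Lemma weighted_sum_limit_basis (R : realType) (H : normedModType R[i])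
    (ip : {dot H for conjC}) (f g : nat -> H) (w : nat -> R) (W : H -> H)
    (j : nat) :
  orthonormal_family ip f -> weighted_sum_limit ip f g w W ->
  W (f j) = (w j)%:C *: g j.
Proof.
move=> of_ /(_ (f j)); apply: (cvg_near_eq (N := j.+1)) => n jn.
rewrite (bigD1_seq j) ?mem_index_iota ?iota_uniq//= of_ eqxx mulr1.
rewrite big1 ?addr0// => k kj.
by rewrite of_ eq_sym (negbTE kj) mulr0 scale0r.
Qed.

Lemma weighted_sum_limit_orthogonal (R : realType) (H : normedModType R[i])
    (ip : {dot H for conjC}) (f g : nat -> H) (w : nat -> R) (W : H -> H)
    (x : H) :
  weighted_sum_limit ip f g w W -> (forall k, ip x (f k) = 0) -> W x = 0.
Proof.
move=> /(_ x) Wx xf; apply: (cvg_near_eq (N := 0%N)) Wx => n _.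
by rewrite big1// => k _; rewrite xf mulr0 scale0r.
Qed.

(** All partial sums beyond [j] have this coordinate, and the inner product is continuous. *)
Lemma weighted_sum_limit_coord (R : realType) (H : normedModType R[i])
    (ip : {dot H for conjC}) (f g : nat -> H) (w : nat -> R) (W : H -> H)
    (x : H) (j : nat) :
  induces_norm ip -> orthonormal_family ip g -> weighted_sum_limit ip f g w W ->
  ip (W x) (g j) = (w j)%:C * ip x (f j).
Proof.
move=> ip_norm og /(_ x) Wx; apply/eqP; rewrite -subr_eq0 -normr_eq0.
rewrite eq_le normr_ge0 andbT; apply/ler_addgt0Pr => e e0; rewrite add0r.
have [N _ /(_ _ (leq_maxl N j.+1))] := near_ip (g j) ip_norm Wx e0.
by rewrite /= ip_orthonormal_suml// leq_maxr.
Qed.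

Lemma ip_limit_ge0 (R : realType) (H : normedModType R[i])
    (ip : {dot H for conjC}) (u : nat -> H) (l y : H) :
  induces_norm ip -> u n @[n --> \oo] --> l ->
  (forall n, 0 <= ip (u n) y) -> 0 <= ip l y.
Proof.
(* In the partial order of [R[i]], nonnegativity of z amounts to the equation [|z| = z], which
   passes to limits. *)
move=> ip_norm ul u0; suff <- : `|ip l y| = ip l y by [].
apply/eqP; rewrite -subr_eq0 -normr_eq0.
rewrite eq_le normr_ge0 andbT; apply/ler_addgt0Pr => e e0; rewrite add0r.
have e20 : 0 < e / 2 by rewrite divr_gt0.
have [N _ /(_ _ (leqnn N)) uN] := near_ip y ip_norm ul e20.
rewrite -(subrKA (ip (u N) y)) (le_trans (ler_normD _ _))// (splitr e) lerD//.
  rewrite -[X in _ - X](ger0_norm (u0 N)) (le_trans (ler_dist_dist _ _))//.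
by rewrite distrC.
Qed.

Lemma linear_zero_on_basis (R : realType) (H : normedModType R[i])
    (ip : {dot H for conjC}) (e : nat -> H) (D : {linear H -> H}) :
  orthonormal_basis ip e -> continuous D -> (forall k, D (e k) = 0) ->
  forall x, D x = 0.
Proof.
move=> [_ ebasis] ctsD De x.
have Dx : D (\sum_(0 <= k < n) ip x (e k) *: e k) @[n --> \oo] --> D x.
  exact: (continuous_cvg _ (ctsD x) (ebasis x)).
apply: (cvg_near_eq (N := 0%N)) Dx => n _.
by rewrite linear_sum big1// => k _; rewrite linearZ /= De scaler0.
Qed.

Lemma diagonal_operator (R : realType) (H : completeNormedModType R[i])
    (ip : {dot H for conjC}) (e : nat -> H) (mu : nat -> R) :
  induces_norm ip -> orthonormal_basis ip e -> (forall k, 0 <= mu k) ->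
  mu k @[k --> \oo] --> (0 : R) ->
  exists T : {linear H -> H},
    [/\ positive_operator ip T, compact_operator T,
        has_eigenvalue_sequence ip T mu
      & (forall k, 0 < mu k) -> strictly_positive_operator ip T].
Proof.
move=> ip_norm ebasis mu0 mucvg; have [oe ecvg] := ebasis.
have [T [tbT Tlim]] := weighted_sum_operator ip_norm oe oe mucvg.
have posT : positive_operator ip T.
  move=> x; apply: (ip_limit_ge0 ip_norm (Tlim x)) => n.
  rewrite linear_sumlz; apply: sumr_ge0 => k _.
  rewrite linearZl_LR /= -mulrA mulr_ge0 ?ler0c//.
  by rewrite (ip_conj ip (e k)) -normCK exprn_ge0.
exists T; split=> //.
- exact: totally_bounded_precompact.
- exists e => // k; exact: weighted_sum_limit_basis Tlim.
- move=> mu_gt0; split=> // x Tx0.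
  apply: (cvg_near_eq (N := 0%N)) (ecvg x) => n _.
  rewrite big1// => k _.
  have := weighted_sum_limit_coord x k ip_norm oe Tlim.
  rewrite Tx0 linear0l => /esym/eqP; rewrite mulf_eq0 => /orP[|/eqP ->].
    by move=> /eqP/complexI muk0; have := mu_gt0 k; rewrite muk0 ltxx.
  by rewrite scale0r.
Qed.

(** * Orthonormal bases *)

Lemma countable_dense_sequence (R : realType) (H : normedModType R[i]) :
  separable H -> exists X : nat -> H,
    forall x (e : R[i]), 0 < e -> exists m, `|x - X m| < e.
Proof.
move=> [D [/countable_injP[f finj] denseD]].
(* [X n] is the point of [D] with code [n], or the default 0 if there is none. *)
exists (fun n => xget 0 [set x | D x /\ f x = n]) => x e e0.
have [|d [xd Dd]] := denseD (ball x e) _ (@ball_open _ _ x e).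
  by exists x; exact: ballxx.
exists (f d); move: xd; rewrite -ball_normE /=.
set y := xget _ _; have [Dy fy] : D y /\ f y = f d.
  by apply: (@xgetPex _ 0 [set x | D x /\ f x = f d]); exists d.
by rewrite (finj y d) ?inE.
Qed.

Definition residual (R : realType) (H : normedModType R[i])
    (ip : {dot H for conjC}) (s : seq H) (x : H) : H :=
  x - \sum_(v <- s) ip x v *: v.

Definition normalize (R : realType) (H : normedModType R[i]) (x : H) : H :=
  `|x|^-1 *: x.

(** Otherwise the finitely many vectors of [s] would span [H]. *)
Lemma residual_neq0 (R : realType) (H : normedModType R[i])
    (ip : {dot H for conjC}) (s : seq H) :
  infinite_dimensional H -> exists x, residual ip s x != 0.
Proof.
move=> infH; apply: contrapT => res0; apply: infH.
exists (size s), (fun i : 'I_(size s) => s`_i) => x.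
exists (fun i : 'I_(size s) => ip x s`_i).
have /eqP : residual ip s x == 0.
  by apply: contrapT => /negP rx; apply: res0; exists x.
move/eqP; rewrite subr_eq0 => /eqP {1}->.
by rewrite (big_nth 0) big_mkord.
Qed.

(* The n-th vector is built from [X n] when [X n] is not yet in the span of its
   predecessors, and from an arbitrary vector outside this span otherwise. *)
Definition gram_schmidt_next (R : realType) (H : normedModType R[i])
    (ip : {dot H for conjC}) (X : nat -> H) (s : seq H) : H :=
  let r := residual ip s (X (size s)) in
  normalize (if r == 0
             then residual ip s (xget 0 [set x | residual ip s x != 0])
             else r).

Definition gram_schmidt_seq (R : realType) (H : normedModType R[i])
    (ip : {dot H for conjC}) (X : nat -> H) (n : nat) : seq H :=
  iter n (fun s => rcons s (gram_schmidt_next ip X s)) [::].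

Definition gram_schmidt (R : realType) (H : normedModType R[i])
    (ip : {dot H for conjC}) (X : nat -> H) (n : nat) : H :=
  gram_schmidt_next ip X (gram_schmidt_seq ip X n).

Lemma gram_schmidt_seqE (R : realType) (H : normedModType R[i])
    (ip : {dot H for conjC}) (X : nat -> H) (n : nat) :
  gram_schmidt_seq ip X n = mkseq (gram_schmidt ip X) n.
Proof. by elim: n => //= n IHn; rewrite mkseqS -IHn. Qed.

Lemma residual_gram_schmidt (R : realType) (H : normedModType R[i])
    (ip : {dot H for conjC}) (X : nat -> H) (n : nat) (x : H) :
  residual ip (gram_schmidt_seq ip X n) x =
  x - \sum_(0 <= k < n) ip x (gram_schmidt ip X k) *: gram_schmidt ip X k.
Proof.
by rewrite /residual gram_schmidt_seqE big_map /index_iota subn0.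
Qed.

(** Merges the two branches of [gram_schmidt_next]: orthonormality uses only that the residual is
    nonzero, the span property uses that it comes from [X n] whenever possible. *)
Lemma gram_schmidt_normalize (R : realType) (H : normedModType R[i])
    (ip : {dot H for conjC}) (X : nat -> H) (n : nat) :
  infinite_dimensional H ->
  exists2 y, residual ip (gram_schmidt_seq ip X n) y != 0 &
    gram_schmidt ip X n = normalize (residual ip (gram_schmidt_seq ip X n) y) /\
    (residual ip (gram_schmidt_seq ip X n) (X n) != 0 -> y = X n).
Proof.
move=> infH; rewrite /gram_schmidt /gram_schmidt_next.
have -> : size (gram_schmidt_seq ip X n) = n.
  by rewrite gram_schmidt_seqE size_mkseq.
set s := gram_schmidt_seq ip X n; case: eqVneq => [r0|r0]; last by exists (X n).
exists (xget 0 [set x | residual ip s x != 0]) => //.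
exact: (@xgetPex _ 0 [set x | residual ip s x != 0] (residual_neq0 ip s infH)).
Qed.

Lemma gram_schmidt_orthonormal (R : realType) (H : normedModType R[i])
    (ip : {dot H for conjC}) (X : nat -> H) :
  induces_norm ip -> infinite_dimensional H ->
  orthonormal_family ip (gram_schmidt ip X).
Proof.
move=> ip_norm infH; set e := gram_schmidt ip X.
suff on n j k : (j < n)%N -> (k < n)%N -> ip (e j) (e k) = (j == k)%:R.
  move=> j k; apply: (on (maxn j k).+1); rewrite ltnS ?leq_maxl ?leq_maxr//.
elim: n j k => // n IHn.
have [y r_neq0 [enE _]] := gram_schmidt_normalize ip X n infH.
have nr_neq0 : `|residual ip (gram_schmidt_seq ip X n) y| != 0.
  by rewrite normr_eq0.
have en_orth k : (k < n)%N -> ip (e n) (e k) = 0.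
  move=> kn; rewrite /e enE /normalize linearZl_LR /=.
  rewrite residual_gram_schmidt linearBl /= ip_delta_suml ?kn ?subrr ?mulr0//.
  by move=> j jn; exact: IHn.
have en_unit : ip (e n) (e n) = 1.
  rewrite -ip_norm /e enE /normalize normrZ normfV normr_id mulVf// expr1n//.
move=> j k; rewrite !ltnS leq_eqVlt => /predU1P[->|jn].
  rewrite leq_eqVlt => /predU1P[->|kn]; first by rewrite eqxx.
  by rewrite en_orth// gtn_eqF.
rewrite leq_eqVlt => /predU1P[->|kn]; last exact: IHn.
by rewrite ip_conj en_orth// conjC0 ltn_eqF.
Qed.

Lemma gram_schmidt_span (R : realType) (H : normedModType R[i])
    (ip : {dot H for conjC}) (X : nat -> H) (m : nat) :
  infinite_dimensional H ->
  exists c : nat -> R[i], X m = \sum_(0 <= k < m.+1) c k *: gram_schmidt ip X k.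
Proof.
move=> infH; have [y _ [eE yE]] := gram_schmidt_normalize ip X m infH.
set e := gram_schmidt ip X in eE *.
set r := residual ip (gram_schmidt_seq ip X m) (X m) in yE.
(* Projection coefficients on the earlier vectors, then the norm of the residual, which is 0 if
   [X m] is already in their span. *)
exists (fun k => if (k < m)%N then ip (X m) (e k) else `|r|).
rewrite big_nat_recr//= ltnn big_nat.
under eq_bigr => k /andP[_ ->] do [].
rewrite -big_nat; have -> : `|r| *: e m = r.
  have [r0|r0] := eqVneq r 0; first by rewrite r0 normr0 scale0r.
  by rewrite eE (yE r0) -/r /normalize scalerA mulfV ?normr_eq0// scale1r.
by rewrite /r residual_gram_schmidt addrC subrK.
Qed.

Lemma orthonormal_basis_exists (R : realType) (H : normedModType R[i])
    (ip : {dot H for conjC}) :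
  induces_norm ip -> separable H -> infinite_dimensional H ->
  exists e : nat -> H, orthonormal_basis ip e.
Proof.
move=> ip_norm /countable_dense_sequence[X Xdense] infH.
have oe := gram_schmidt_orthonormal X ip_norm infH.
exists (gram_schmidt ip X); set e := gram_schmidt ip X in oe *; split=> // x.
apply/cvgrPdist_le => eps eps0; have [m xm] := Xdense x _ eps0.
(* From [m.+1] on the projection [P] fixes [X m], so [x - P x] is the residual of [x - X m], and
   taking residuals does not increase norms. *)
exists m.+1 => // n /= mn; pose P y := \sum_(0 <= k < n) ip y (e k) *: e k.
have PX : P (X m) = X m.
  have [c XE] := gram_schmidt_span ip X m infH.
  have tail0 : \sum_(m.+1 <= k < n) ip (X m) (e k) *: e k = 0.
    rewrite big_nat big1// => k /andP[mk _].
    by rewrite XE ip_orthonormal_suml//= ltnNge mk scale0r.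
  rewrite [RHS]XE /P (@big_cat_nat _ _ _ m.+1)//= tail0 addr0.
  by apply: eq_big_nat => k km; rewrite XE ip_orthonormal_suml// km.
apply: le_trans (ltW xm).
have -> : x - P x = (x - X m) - P (x - X m).
  have -> : P (x - X m) = P x - P (X m).
    rewrite /P -sumrB; apply: eq_bigr => k _.
    by rewrite linearBl /= scalerBl.
  by rewrite PX opprB addrA subrK.
apply: norm_le_sqr => //; rewrite sqr_norm_residual// gerBl.
by rewrite sumr_ge0// => k _; rewrite exprn_ge0.
Qed.

(** * Block sequences *)

(** This is n(n+1)/2, the position where block [n] starts, blocks being counted from 0 and block [n]
    having n + 1 entries. *)
Definition triangular (n : nat) : nat := 'C(n.+1, 2).

Lemma triangularS (n : nat) : triangular n.+1 = (triangular n + n.+1)%N.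
Proof. by rewrite /triangular binS bin1. Qed.

Lemma leq_triangular (m n : nat) :
  (m <= n)%N -> (triangular m <= triangular n)%N.
Proof.
move=> /subnK <-; elim: (n - m)%N => // k.
rewrite addSn triangularS => /leq_trans.
by apply; rewrite leq_addr.
Qed.

Lemma triangular_coords (k : nat) :
  exists n i : nat, (i <= n)%N /\ k = (triangular n + i)%N.
Proof.
elim: k => [|k [n [i [i_n ->]]]]; first by exists 0%N, 0%N.
have [in_|ni] := ltnP i n; first by exists n, i.+1; rewrite addnS.
exists n.+1, 0%N; split=> //.
by rewrite triangularS addn0 -addnS (eqP (_ : i == n))// eqn_leq i_n.
Qed.

Lemma triangular_coords_lt (n i m j : nat) : (i <= n)%N ->
  (n < m)%N -> (triangular n + i < triangular m + j)%N.
Proof.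
move=> i_n /leq_triangular; rewrite triangularS => /(leq_trans _)/leq_trans.
move=> /(_ (triangular n + i).+1); apply; last exact: leq_addr.
by rewrite -addnS leq_add2l.
Qed.

Lemma triangular_coords_inj (n i m j : nat) : (i <= n)%N -> (j <= m)%N ->
  (triangular n + i = triangular m + j)%N -> n = m /\ i = j.
Proof.
move=> i_n jm e; case: (ltngtP n m) => nm.
- by have := triangular_coords_lt j i_n nm; rewrite e ltnn.
- by have := triangular_coords_lt i jm nm; rewrite e ltnn.
- by split=> //; move: e; rewrite nm => /addnI.
Qed.

Lemma block_sequenceE (R : realType) (a : nat -> R) (n i : nat) :
  (i <= n)%N -> block_sequence a (triangular n + i) = a n.+1.
Proof.
move=> i_n; rewrite /block_sequence; set N := (triangular n + i).+1.
have nN : (n < N)%N.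
  rewrite /N ltnS (@leq_trans (triangular n)) ?leq_addr//.
  by case: (n) => // m; rewrite triangularS leq_addl.
pose F m := flatten [seq nseq j (a j) | j <- iota 1 m].
have sizeF m : size (F m) = triangular m.
  elim: m => // m IHm; rewrite /F -[in iota _ _](addn1 m).
  rewrite iotaD map_cat flatten_cat size_cat.
  by rewrite -/(F m) IHm /= cats0 size_nseq triangularS ?add1n.
(* The first [n] of the [N] listed blocks have total length [triangular n], so the entry falls into
   the next one, which repeats [a n.+1]. *)
have NE : N = (n + (N - n.+1).+1)%N by rewrite -addSnnS (subnKC nN).
rewrite NE.
rewrite iotaD map_cat flatten_cat nth_cat -/(F n) sizeF ifF; last first.
  by rewrite ltnNge leq_addr.
rewrite addKn; set K := (N - n.+1)%N.
have -> : flatten [seq nseq j (a j) | j <- iota (1 + n) K.+1] =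
    nseq n.+1 (a n.+1) ++ flatten [seq nseq j (a j) | j <- iota n.+2 K] by [].
by rewrite nth_cat size_nseq ltnS i_n nth_nseq ltnS i_n.
Qed.

Lemma eq_block_sequence (R : realType) (a b : nat -> R) :
  (forall n, (1 <= n)%N -> a n = b n) -> block_sequence a =1 block_sequence b.
Proof.
move=> ab k; have [n [i [i_n ->]]] := triangular_coords k.
by rewrite !block_sequenceE// ab.
Qed.

Lemma cvg_block_sequence (R : realType) (a : nat -> R) (l : R) :
  a n @[n --> \oo] --> l -> block_sequence a k @[k --> \oo] --> l.
Proof.
move=> /cvgrPdist_le al; apply/cvgrPdist_le => e /al[N _ aN].
exists (triangular N) => // k /=; have [n [i [i_n ->]]] := triangular_coords k.
move=> Nk; rewrite block_sequenceE//; apply: aN => /=; rewrite leqW//.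
rewrite leqNgt; apply/negP => nN.
by have := triangular_coords_lt 0 i_n nN; rewrite addn0 ltnNge Nk.
Qed.

(** Names the function inside [difference_sequence], to which it is convertible. *)
Definition difference_coefficient (R : realType) (d : nat -> R) (n : nat) : R :=
  if n == 1%N then d 1%N else (d n - d n.-1) / n%:R.

Lemma difference_coefficient_ge0 (R : realType) (d : nat -> R) (n : nat) :
  difference_condition d -> (1 <= n)%N -> 0 <= difference_coefficient d n.
Proof.
move=> [d0 dle _]; rewrite /difference_coefficient.
case: n => // -[_|n _]; first exact: d0.
by rewrite divr_ge0// subr_ge0 dle.
Qed.

Lemma difference_sequence_ge0 (R : realType) (d : nat -> R) (k : nat) :
  difference_condition d -> 0 <= difference_sequence d k.
Proof.
move=> dcond; have [n [i [i_n ->]]] := triangular_coords k.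
rewrite /difference_sequence block_sequenceE//.
exact: (difference_coefficient_ge0 (n := n.+1)).
Qed.

(** The coefficients lie between 0 and [d n / n], because the subtracted [d n.-1] is nonnegative. *)
Lemma difference_sequence_cvg0 (R : realType) (d : nat -> R) :
  difference_condition d -> difference_sequence d k @[k --> \oo] --> (0 : R).
Proof.
move=> dcond; have [d0 dle dcvg] := dcond; apply: cvg_block_sequence.
move/cvgrPdist_le : dcvg => dcvg; apply/cvgrPdist_le => e /dcvg[N _ dN].
exists N.+1 => // n /= Nn; have n1 : (1 <= n)%N by exact: leq_trans Nn.
have := dN n (ltnW Nn); rewrite !sub0r !normrN => /(le_trans _); apply.
have a0 := difference_coefficient_ge0 dcond n1.
rewrite -/(difference_coefficient d n) !ger0_norm ?divr_ge0 ?d0//.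
rewrite /difference_coefficient; case: n n1 {Nn a0} => // -[_|n _] /=.
  by rewrite divr1.
by rewrite ler_pM2r ?invr_gt0 ?ltr0n// gerBl d0.
Qed.

(* Both conditions describe the same sequences through
   [d' n = n * difference_coefficient d n] and
   [d n = \sum_(1 <= j < n.+1) d' j]. *)
Lemma difference_average_equiv (R : realType) (mu : nat -> R) :
  (exists2 d : nat -> R,
     difference_condition d & mu =1 difference_sequence d) <->
  (exists2 d : nat -> R, average_condition d & mu =1 quotient_sequence d).
Proof.
split=> [[d dcond muE]|[d [d0 davg] muE]].
  pose d' n := n%:R * difference_coefficient d n.
  (* The sum telescopes, the exceptional coefficient at 1 supplying [d 1]. *)
  have sum_d' n : (1 <= n)%N -> \sum_(1 <= j < n.+1) d' j = d n.
    elim: n => // -[_ _|n IHn _].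
      by rewrite big_nat1 /d' /difference_coefficient mul1r.
    rewrite big_nat_recr//= IHn// /d' /difference_coefficient /=.
    by rewrite mulrC divfK ?pnatr_eq0// addrC subrK.
  exists d'; last first.
    move=> k; rewrite muE; apply: eq_block_sequence => n n1.
    by rewrite /d' mulrAC mulfV ?mul1r// pnatr_eq0 -lt0n.
  split=> [n n1|]; first by rewrite mulr_ge0// difference_coefficient_ge0.
  have [_ _ /cvgrPdist_le dcvg] := dcond.
  apply/cvgrPdist_le => e /dcvg[N _ dN]; exists N.+1 => // n /= Nn.
  rewrite sum_d'; last exact: leq_trans Nn.
  by rewrite mulrC; apply: dN => /=; exact: ltnW.
exists (fun n => \sum_(1 <= j < n.+1) d j); last first.
  move=> k; rewrite muE; apply: eq_block_sequence => -[//|[|n]] _ /=.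
    by rewrite big_nat1 divr1.
  by rewrite big_nat_recr//= addrAC subrr add0r.
split=> [n _|m n _ mn|]; last by under eq_fun do rewrite mulrC.
  by rewrite big_nat sumr_ge0// => j /andP[j1 _]; exact: d0.
rewrite [leRHS](@big_cat_nat _ _ _ m.+1)//= lerDl.
by rewrite big_nat sumr_ge0// => j /andP[mj _]; rewrite d0// (leq_trans _ mj).
Qed.

(** * The square root and logarithm sequences *)

Lemma difference_sequence_gt0 (R : realType) (d : nat -> R) (k : nat) :
  (forall n, (1 <= n)%N -> d n < d n.+1) -> 0 < difference_sequence d k.+1.
Proof.
move=> d_incr; have [n [i [i_n kE]]] := triangular_coords k.+1.
rewrite kE /difference_sequence block_sequenceE//.
case: n i_n kE => [|n _ _]; first by rewrite leqn0 => /eqP ->.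
by rewrite /= divr_gt0// subr_gt0 d_incr.
Qed.

Lemma sqrt_div_le (R : realType) (e : R) : 0 < e ->
  exists N : nat, forall n, (N <= n)%N -> Num.sqrt n%:R / n%:R <= e.
Proof.
(* The quotient equals the inverse of the square root of n, so n must exceed the inverse square of
   [e]. *)
move=> e0; exists (Num.truncn (e ^- 2)).+1 => n Nn.
have n0 : 0 < n%:R :> R by rewrite ltr0n (leq_trans _ Nn).
have en : e ^- 2 <= n%:R.
  by rewrite (le_trans (ltW (truncnS_gt _)))// ler_nat.
have s0 : 0 < Num.sqrt n%:R :> R by rewrite sqrtr_gt0.
rewrite -{2}(sqr_sqrtr (ltW n0)) expr2 invfM mulrA mulfV ?gt_eqF// mul1r.
rewrite -[leRHS]invrK lef_pV2 ?posrE ?invr_gt0//.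
rewrite -(@ler_pXn2r _ 2) ?nnegrE ?invr_ge0 ?(ltW e0) ?(ltW s0)//.
by rewrite exprVn sqr_sqrtr ?(ltW n0).
Qed.

Lemma sqrt_difference_condition (R : realType) :
  difference_condition (fun n => Num.sqrt n%:R : R).
Proof.
split=> [n _|m n _ mn|]; first exact: sqrtr_ge0.
  by rewrite ler_wsqrtr// ler_nat.
apply/cvgrPdist_le => e /sqrt_div_le[N eN]; exists N => // n /= Nn.
by rewrite sub0r normrN ger0_norm ?eN// divr_ge0// sqrtr_ge0.
Qed.

Lemma ln_difference_condition (R : realType) :
  difference_condition (fun n => ln n%:R : R).
Proof.
split=> [n n1|m n m1 mn|]; first by rewrite ln_ge0// ler1n.
  by rewrite ler_ln ?posrE ?ltr0n ?ler_nat// (leq_trans m1).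
apply/cvgrPdist_le => e e0.
have [|N eN] := @sqrt_div_le R (e / 2); first by rewrite divr_gt0.
exists N.+1 => // n /= Nn; have n1 : (1 <= n)%N by exact: leq_trans Nn.
rewrite sub0r normrN ger0_norm ?divr_ge0 ?ln_ge0 ?ler1n//.
have n0 : 0 < n%:R :> R by rewrite ltr0n.
have s0 : 0 < Num.sqrt n%:R :> R by rewrite sqrtr_gt0.
(* ln n is twice the logarithm of the square root of n, and ln x < x; this reduces the claim to the
   square root bound for [e / 2]. *)
have ln_le : ln n%:R <= Num.sqrt n%:R * 2 :> R.
  rewrite -{1}(sqr_sqrtr (ltW n0)) lnXn// -(mulr_natr (ln _)) ler_pM2r//.
  by rewrite ltW// ln_sublinear.
apply: (@le_trans _ _ (Num.sqrt n%:R / n%:R * 2)); last first.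
  by rewrite -ler_pdivlMr// eN// ltnW.
by rewrite mulrAC ler_pM2r ?invr_gt0.
Qed.

(** * The commutator *)

(** Raising operators take [phi] to be the identity, lowering operators take [psi] to be the
    identity; the last clause gives the vectors that a lowering operator kills. *)
Lemma weighted_shift (R : realType) (H : completeNormedModType R[i])
    (ip : {dot H for conjC}) (e : nat -> H) (phi psi : nat -> nat)
    (w : nat -> R) :
  induces_norm ip -> orthonormal_family ip e -> injective phi ->
  injective psi -> w k @[k --> \oo] --> (0 : R) ->
  exists W : {linear H -> H},
    [/\ totally_bounded (W @` [set x : H | `|x| <= 1]),
        forall k, W (e (phi k)) = (w k)%:C *: e (psi k)
      & forall m, (forall k, m != phi k) -> W (e m) = 0].
Proof.
move=> ip_norm oe phiI psiI w0.
have of_ : orthonormal_family ip (e \o phi).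
  by move=> j k; rewrite /= oe (inj_eq phiI).
have og : orthonormal_family ip (e \o psi).
  by move=> j k; rewrite /= oe (inj_eq psiI).
have [W [tbW Wlim]] := weighted_sum_operator ip_norm of_ og w0.
exists W; split=> // [k|m mphi]; first exact: weighted_sum_limit_basis Wlim.
apply: weighted_sum_limit_orthogonal Wlim _ => k.
by rewrite /= oe (negbTE (mphi k)).
Qed.

Lemma compact_operator_add (R : realType) (H : completeNormedModType R[i])
    (S T : {linear H -> H}) :
  totally_bounded (S @` [set x : H | `|x| <= 1]) ->
  totally_bounded (T @` [set x : H | `|x| <= 1]) ->
  exists2 U : {linear H -> H}, compact_operator U & forall x, U x = S x + T x.
Proof.
move=> tbS tbT.
have [|U UE] := @exists_linear _ _ (fun x => S x + T x).
  by move=> a x y; rewrite !linearP scalerDr addrACA.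
exists U => //; apply: totally_bounded_precompact.
apply: totally_bounded_subset (totally_bounded_sum tbS tbT) => _ [x x1 <-].
by rewrite UE; exists (S x); [exists x | exists (T x) => //; exists x].
Qed.

Lemma cvg0_sqrt (R : realType) (c : nat -> R) :
  c n @[n --> \oo] --> (0 : R) -> Num.sqrt (c n) @[n --> \oo] --> (0 : R).
Proof.
move=> c0; apply/cvgrPdist_le => e e0.
have [|m cm] := cvg0_le c0 (_ : 0 < e ^+ 2); first by rewrite exprn_gt0.
exists m => // n /= mn; rewrite sub0r normrN ger0_norm ?sqrtr_ge0//.
rewrite -(ger0_norm (ltW e0)) -sqrtr_sqr ler_wsqrtr//.
by rewrite (le_trans (ler_norm _))// cm.
Qed.

(** [u] is indexed by blocks and [w] by positions; blocks are finite, so the block number tends to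
    infinity with the position. *)
Lemma cvg0_dominated_triangular (R : realType) (u w : nat -> R)
    (blk off : nat -> nat) :
  (forall k, (off k <= blk k)%N /\ k = (triangular (blk k) + off k)%N) ->
  u n @[n --> \oo] --> (0 : R) -> (forall k, `|w k| <= `|u (blk k)|) ->
  w k @[k --> \oo] --> (0 : R).
Proof.
move=> coords u0 wu; apply/cvgrPdist_le => e e0.
have [N uN] := cvg0_le u0 e0.
exists (triangular N) => // k /= Nk; rewrite sub0r normrN (le_trans (wu k))//.
apply: uN; rewrite leqNgt; apply/negP => kN; have [ik kE] := coords k.
by have := triangular_coords_lt 0 ik kN; rewrite addn0 -kE ltnNge Nk.
Qed.

(** As [t <= s], the shifted offset stays within its shifted block, where coordinates are unique. *)
Lemma triangular_shift_inj (s t : nat) (blk off : nat -> nat) :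
  (t <= s)%N ->
  (forall k, (off k <= blk k)%N /\ k = (triangular (blk k) + off k)%N) ->
  injective (fun k => triangular (blk k + s) + (off k + t))%N.
Proof.
move=> ts coords j k; have [ij jE] := coords j; have [ik kE] := coords k.
move=> /triangular_coords_inj[||/addIn bE /addIn oE]; rewrite ?leq_add//.
by rewrite jE kE bE oE.
Qed.

(* [A2] is minus the weighted derivative with respect to z2, so that here
   Z = B1 + A2. *)
Lemma monomial_commutator (K : numFieldType) (V : lmodType K)
    (E : nat -> nat -> V) (A1 A2 B1 B2 : {linear V -> V}) (u : nat -> K) :
  (forall n i, (i <= n)%N -> B1 (E n i) = u n *: E n.+1 i.+1) ->
  (forall n i, (i <= n)%N -> B2 (E n i) = u n *: E n.+1 i) ->
  (forall n i, (i <= n)%N ->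
     A1 (E n.+1 i.+1) = (i.+1%:R / n.+1%:R * u n) *: E n i) ->
  (forall n, A1 (E n 0%N) = 0) ->
  (forall n i, (i <= n)%N ->
     A2 (E n.+1 i) = (- ((n - i).+1%:R / n.+1%:R * u n)) *: E n i) ->
  (forall n, A2 (E n n) = 0) ->
  forall n i, (i <= n)%N ->
    (A1 (B1 (E n i) + A2 (E n i)) + B2 (B1 (E n i) + A2 (E n i))) -
    (B1 (A1 (E n i) + B2 (E n i)) + A2 (A1 (E n i) + B2 (E n i))) =
    (u n ^+ 2 * n.+2%:R / n.+1%:R - if n is m.+1 then u m ^+ 2 else 0) *: E n i.
Proof.
move=> B1E B2E A1E A1E0 A2E A2E0 n i i_n.
have A1Z c x : A1 (c *: x) = c *: A1 x by exact: linearZ.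
have A2Z c x : A2 (c *: x) = c *: A2 x by exact: linearZ.
have B1Z c x : B1 (c *: x) = c *: B1 x by exact: linearZ.
have B2Z c x : B2 (c *: x) = c *: B2 x by exact: linearZ.
have commB : B2 (B1 (E n i)) = B1 (B2 (E n i)).
  by rewrite B1E// B2E// B1Z B2Z B1E ?leqW// B2E// !scalerA mulrC.
(* Both sides vanish on the boundary monomials [i = 0] and [i = n]; inside, the two products of
   weights agree. *)
have commA : A1 (A2 (E n i)) = A2 (A1 (E n i)).
  case: i i_n {commB} => [_|i].
    rewrite A1E0 linear0; case: n => [|n]; first by rewrite A2E0 linear0.
    by rewrite A2E// A1Z A1E0 scaler0.
  case: n => // n; rewrite ltnS => i_n.
  have [->|ni] := eqVneq i n.
    by rewrite A2E0 A1E// linear0 A2Z A2E0 scaler0.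
  have {ni} : (i < n)%N by rewrite ltn_neqAle ni.
  case: n i_n => // n i_n; rewrite ltnS => i_n'.
  rewrite A2E// A1E// A1Z A2Z A1E// A2E// !scalerA subSS; congr (_ *: _).
  by ring.
have comm1 : A1 (B1 (E n i)) - B1 (A1 (E n i)) =
    (i.+1%:R / n.+1%:R * u n ^+ 2 -
     if n is m.+1 then i%:R / n%:R * u m ^+ 2 else 0) *: E n i.
  rewrite B1E// A1Z A1E// scalerA.
  case: i i_n {commB commA} => [_|i].
    rewrite A1E0 linear0 subr0; congr (_ *: _).
    by case: (n) => [|m]; rewrite ?mulr0n ?mul0r; ring.
  case: n => // n; rewrite ltnS => i_n.
  by rewrite A1E// B1Z B1E// scalerA -scalerBl; congr (_ *: _); ring.
have comm2 : B2 (A2 (E n i)) - A2 (B2 (E n i)) =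
    ((n - i).+1%:R / n.+1%:R * u n ^+ 2 -
     if n is m.+1 then (n - i)%:R / n%:R * u m ^+ 2 else 0) *: E n i.
  rewrite B2E// A2Z A2E// scalerA.
  have [->|ni] := eqVneq i n.
    rewrite A2E0 linear0 sub0r -scaleNr subnn; congr (_ *: _).
    by case: (n) => [|m]; rewrite ?mulr0n ?mul0r; ring.
  have {ni} : (i < n)%N by rewrite ltn_neqAle ni.
  case: n i_n {commB commA comm1} => // n _; rewrite ltnS => i_n.
  by rewrite A2E// B2Z B2E// scalerA -scalerBl subSn//; congr (_ *: _); ring.
rewrite !linearD /= commA commB.
(* The cross terms cancel because the A's commute and the B's commute. *)
transitivity ((A1 (B1 (E n i)) - B1 (A1 (E n i))) +
              (B2 (A2 (E n i)) - A2 (B2 (E n i)))).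
  move: (A1 (B1 _)) (A2 (A1 _)) (B1 (B2 _)) (B2 (A2 _)) => a x b y.
  move: (B1 (A1 _)) (A2 (B2 _)) => a' y'.
  rewrite [b + y]addrC (addrACA a) [- x - y']addrC (addrACA (- a')).
  rewrite (addrACA (a + y)) [x + b + _]addrA addrK subrr addr0.
  exact: addrACA.
rewrite comm1 comm2 -scalerDl; congr (_ *: _).
(* The shares add up independently of [i]: (i+1) + (n-i+1) = n+2 in the first term and i + (n-i) = n
   in the second. *)
case: n i_n {commA commB comm1 comm2} => [|n] i_n.
  by move: i_n; rewrite leqn0 => /eqP->; rewrite subn0; field.
rewrite -[(n.+1 - i).+1]addn1 -[i.+1]addn1 !natrD natrB//.
have h1 : n.+1%:R != 0 :> K by rewrite pnatr_eq0.
have h2 : n.+2%:R != 0 :> K by rewrite pnatr_eq0.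
move: h2; rewrite -[n.+3]addn1 -[n.+2]addn1 !natrD.
move: (n.+1%:R) h1 => N h1 h2.
by field; rewrite h1 h2.
Qed.

Lemma difference_commutator (R : realType) (H : completeNormedModType R[i])
    (ip : {dot H for conjC}) (d : nat -> R) (T : {linear H -> H}) :
  induces_norm ip -> difference_condition d -> compact_operator T ->
  has_eigenvalue_sequence ip T (difference_sequence d) ->
  commutator_of_compacts T.
Proof.
move=> ip_norm dcond cptT [e ebasis Te]; have [oe _] := ebasis.
have [d0 _ dcvg] := dcond.
have [blk] := choice triangular_coords.
move=> /choice[off coords].
have coordsE n i : (i <= n)%N ->
    blk (triangular n + i)%N = n /\ off (triangular n + i)%N = i.
  move=> i_n; have [ik kE] := coords (triangular n + i)%N.
  by apply: triangular_coords_inj => //; rewrite -kE.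
pose E n i := e (triangular n + i)%N.
pose u n := Num.sqrt (d n.+1 / n.+2%:R).
have u2 n : u n ^+ 2 = d n.+1 / n.+2%:R by rewrite sqr_sqrtr// divr_ge0// d0.
have ucvg : u n @[n --> \oo] --> (0 : R).
  apply: cvg0_sqrt; apply/cvgrPdist_le => eps eps0.
  have [N dN] := cvg0_le dcvg eps0; exists N => // n /= Nn.
  rewrite sub0r normrN ger0_norm ?divr_ge0 ?d0//.
  apply: le_trans (dN n.+1 (leqW Nn)); apply: le_trans (ler_norm _).
  by rewrite ler_wpM2l ?d0// lef_pV2 ?posrE ?ltr0n// ler_nat.
(* Takes the position of [E n i] to that of [E n.+1 (i + t)]: multiplication by z1 for [t = 1], by
   z2 for [t = 0]. *)
pose shift t k := (triangular (blk k + 1) + (off k + t))%N.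
have shiftI t : (t <= 1)%N -> injective (shift t).
  by move=> t1; exact: triangular_shift_inj t1 coords.
have shiftE t n i : (i <= n)%N ->
    shift t (triangular n + i)%N = (triangular n.+1 + (i + t))%N.
  by move=> i_n; rewrite /shift; have [-> ->] := coordsE _ _ i_n; rewrite addn1.
(* The fraction is at most 1, so these weights are dominated by [u]. *)
have frac_cvg (f : nat -> nat) : (forall k, (f k <= blk k)%N) ->
    ((f k).+1%:R / (blk k).+1%:R * u (blk k)) @[k --> \oo] --> (0 : R).
  move=> f_le; apply: cvg0_dominated_triangular coords ucvg _ => k.
  rewrite normrM ler_piMl// ger0_norm ?divr_ge0//.
  by rewrite ler_pdivrMr ?ltr0n// mul1r ler_nat ltnS.
have wcvg : u (blk k) @[k --> \oo] --> (0 : R).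
  exact: cvg0_dominated_triangular coords ucvg _.
have idI : injective (@id nat) by [].
have [B1 [tbB1 B1w _]] := weighted_shift ip_norm oe idI (shiftI 1%N isT) wcvg.
have [B2 [tbB2 B2w _]] := weighted_shift ip_norm oe idI (shiftI 0%N isT) wcvg.
have [A1 [tbA1 A1w A1w0]] := weighted_shift ip_norm oe (shiftI 1%N isT) idI
  (frac_cvg off (fun k => (coords k).1)).
have w2cvg : - ((blk k - off k).+1%:R / (blk k).+1%:R * u (blk k))
    @[k --> \oo] --> (0 : R).
  rewrite -oppr0; apply: cvgN; apply: frac_cvg => k; exact: leq_subr.
have [A2 [tbA2 A2w A2w0]] :=
  weighted_shift ip_norm oe (shiftI 0%N isT) idI w2cvg.
have [C cptC CE] := compact_operator_add tbA1 tbB2.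
have [Z cptZ ZE] := compact_operator_add tbB1 tbA2.
exists C, Z; split=> //.
have comm n i : (i <= n)%N -> C (Z (E n i)) - Z (C (E n i)) =
    ((u n)%:C ^+ 2 * n.+2%:R / n.+1%:R -
     if n is m.+1 then (u m)%:C ^+ 2 else 0) *: E n i.
  rewrite !CE !ZE.
  apply: (@monomial_commutator _ _ E A1 A2 B1 B2 (fun n => (u n)%:C)) => {n i}.
  - move=> n i i_n; have := B1w (triangular n + i)%N.
    by rewrite shiftE// (coordsE _ _ i_n).1 addn1.
  - move=> n i i_n; have := B2w (triangular n + i)%N.
    by rewrite shiftE// (coordsE _ _ i_n).1 addn0.
  - move=> n i i_n; have := A1w (triangular n + i)%N.
    rewrite shiftE// (coordsE _ _ i_n).1 (coordsE _ _ i_n).2 addn1 => ->.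
    by rewrite !rmorphM /= fmorphV !rmorph_nat.
  (* Offset 0 is never reached by [shift 1], which produces positive offsets. *)
  - move=> n; apply: A1w0 => k; apply/eqP => /triangular_coords_inj[]//.
      by rewrite leq_add// (coords k).1.
    by move=> _ /eqP; rewrite addn1.
  - move=> n i i_n; have := A2w (triangular n + i)%N.
    rewrite shiftE// (coordsE _ _ i_n).1 (coordsE _ _ i_n).2 addn0 => ->.
    by rewrite rmorphN !rmorphM /= fmorphV !rmorph_nat.
  (* The last offset of a block is never reached by [shift 0], which keeps the offset and enlarges
     the block. *)
  - move=> n; apply: A2w0 => k; apply/eqP => /triangular_coords_inj[]//.
      by rewrite addn0 addn1 leqW// (coords k).1.
    by move=> -> bo; have := (coords k).1; rewrite -[off k]addn0 -bo addn1 ltnn.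
(* The defect is continuous, so it suffices that it vanishes on the basis. *)
pose D : {linear H -> H} := T \- ((C \o Z) \- (Z \o C)).
have DE x : D x = T x - (C (Z x) - Z (C x)) by [].
have ctsT := compact_operator_continuous cptT.
have ctsC := compact_operator_continuous cptC.
have ctsZ := compact_operator_continuous cptZ.
have ctsD : continuous D.
  move=> x; apply: cvgB; first exact: ctsT.
  apply: cvgB.
    exact: (continuous_comp (ctsZ x) (ctsC (Z x))).
  exact: (continuous_comp (ctsC x) (ctsZ (C x))).
move=> x; apply/eqP; rewrite -subr_eq0 -DE; apply/eqP.
apply: (linear_zero_on_basis ebasis ctsD) => k; rewrite DE.
have [ik ->] := coords k; rewrite -/(E _ _) comm//.
rewrite Te /difference_sequence block_sequenceE// -scalerBl.
suff <- : (u (blk k))%:C ^+ 2 * (blk k).+2%:R / (blk k).+1%:R -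
    (if blk k is m.+1 then (u m)%:C ^+ 2 else 0) =
    (difference_coefficient d (blk k).+1)%:C by rewrite subrr scale0r.
(* Block 0 has nothing to subtract and gives [d 1], matching the exceptional first coefficient. *)
case: (blk k) => [|n].
  rewrite -rmorphXn u2 subr0 divr1 -(rmorph_nat (real_complex R)) -rmorphM /=.
  by rewrite divfK// pnatr_eq0.
rewrite -!rmorphXn !u2 -!(rmorph_nat (real_complex R)) -fmorphV.
rewrite -!rmorphM -rmorphB divfK ?pnatr_eq0//.
by rewrite /difference_coefficient /= mulrBl.
Qed.

(** * Existence of the operators and the full statement *)

Lemma difference_example (R : realType) (H : completeNormedModType R[i])
    (ip : {dot H for conjC}) (d : nat -> R) :
  induces_norm ip -> separable H -> infinite_dimensional H ->
  difference_condition d ->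
  exists T : {linear H -> H},
    [/\ positive_operator ip T, compact_operator T,
        has_eigenvalue_sequence ip T (difference_sequence d),
        commutator_of_compacts T
      & (forall k, 0 < difference_sequence d k) ->
        strictly_positive_operator ip T].
Proof.
move=> ip_norm sepH infH dcond.
have [e ebasis] := orthonormal_basis_exists ip_norm sepH infH.
have [T [posT cptT eigT strictT]] := diagonal_operator ip_norm ebasis
  (fun k => difference_sequence_ge0 k dcond) (difference_sequence_cvg0 dcond).
by exists T; split=> //; exact: difference_commutator eigT.
Qed.

Theorem theorem3p1 (R : realType) (H : completeNormedModType R[i])
    (ip : {dot H for conjC}) (ip_norm : induces_norm ip)
    (H_separable : separable H) (H_infinite : infinite_dimensional H) :
  [/\ forall (d : nat -> R) (T : {linear H -> H}),
        difference_condition d ->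
        positive_operator ip T -> compact_operator T ->
        has_eigenvalue_sequence ip T (difference_sequence d) ->
        commutator_of_compacts T,
      difference_condition (fun n => Num.sqrt n%:R : R) /\
      (exists T : {linear H -> H},
         [/\ strictly_positive_operator ip T, compact_operator T,
             has_eigenvalue_sequence ip T
               (difference_sequence (fun n => Num.sqrt n%:R : R))
           & commutator_of_compacts T]),
      (* Since log 1 = 0, the eigenvalue sequence of d_n = log n starts with 0,
         so T is not strictly positive; all its other terms are positive. *)
      difference_condition (fun n => ln n%:R : R) /\
      (exists T : {linear H -> H},
         [/\ positive_operator ip T, compact_operator T,
             has_eigenvalue_sequence ip T
               (difference_sequence (fun n => ln n%:R : R))
           & commutator_of_compacts T]) /\
      (forall k : nat, 0 < difference_sequence (fun n => ln n%:R : R) k.+1),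
      forall mu : nat -> R,
        (exists2 d : nat -> R,
           difference_condition d & mu =1 difference_sequence d) <->
        (exists2 d : nat -> R,
           average_condition d & mu =1 quotient_sequence d)
    & forall (d : nat -> R) (T : {linear H -> H}),
        average_condition d ->
        positive_operator ip T -> compact_operator T ->
        has_eigenvalue_sequence ip T (quotient_sequence d) ->
        commutator_of_compacts T].
Proof.
have ln_gt0S k : 0 < difference_sequence (fun n => ln n%:R : R) k.+1.
  apply: difference_sequence_gt0 => n n1.
  by rewrite ltr_ln ?posrE ?ltr0n// ltr_nat.
(* The entry at index 0 is [d 1], not an increment, and is treated separately. *)
have sqrt_gt0 k : 0 < difference_sequence (fun n => Num.sqrt n%:R : R) k.
  case: k => [|k]; last first.
    apply: difference_sequence_gt0 => n n1.
    by rewrite ltr_sqrt ?ltr0n// ltr_nat.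
  suff -> : difference_sequence (fun n => Num.sqrt n%:R : R) 0 = Num.sqrt 1.
    by rewrite sqrtr1.
  exact: (@block_sequenceE _ _ 0%N 0%N).
split.
- by move=> d T dcond _ cptT; exact: difference_commutator.
- split; first exact: sqrt_difference_condition.
  have [T [posT cptT eigT commT strictT]] := difference_example ip_norm
    H_separable H_infinite (sqrt_difference_condition R).
  by exists T; split=> //; exact: strictT.
- split; first exact: ln_difference_condition.
  split=> //; have [T [posT cptT eigT commT _]] := difference_example ip_norm
    H_separable H_infinite (ln_difference_condition R).
  by exists T.
- exact: difference_average_equiv.
- move=> d T dcond _ cptT [e ebasis Te].
  (* The same eigenvalue sequence is a difference sequence for the partial sums of [d], so the first
     case applies to [T] itself. *)
  have [|d' d'cond dE] := (difference_average_equiv (quotient_sequence d)).2.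
    by exists d.
  apply: difference_commutator ip_norm d'cond cptT _.
  by exists e => // k; rewrite Te dE.
Qed.
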